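(* Let $n^*=\min\{n\ge1:\ \mathcal T^{(1)}_{n,n}-(n+2)\,\mathcal T^{(1)}_{n,1}\ge0\}$. For $\lambda=[\lambda_1,\lambda_2,\dots]\in\mathcal Q=\prod_{k\ge1}[0,1]$ define the array $\mathcal T^{(1)}(\lambda)$, for $n\ge0$ and $1\le j\le n+1$, by $$\mathcal T^{(1)}_{n,j}(\lambda_n)=\begin{cases}\mathcal T^{(1)}_{n,j}, & n<n^*,\ 1\le j\le n+1,\\ \mathcal T^{(1)}_{n,j}-\lambda_n\mathcal T^{(1)}_{n,1}, & n\ge n^*,\ 1\le j\le n,\\ \mathcal T^{(1)}_{n,j}+n\lambda_n\mathcal T^{(1)}_{n,1}, & n\ge n^*,\ j=n+1,\end{cases}$$ regarded as an infinite matrix with rows $n\ge0$ and columns $j\ge1$ by setting all entries with $j\ge n+2$ equal to $0$. Then $\mathcal T^{(1)}(\lambda)\in\mathcal M^{\infty}$ for every $\lambda\in\mathcal Q$.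
   Context: Define $\psi:\{1,2,3,\dots\}\to\{0,1,2,\dots\}$ by $\psi(1)=0$, $\psi(2)=1$, $\psi(3)=2$ and $\psi(j)=\sum_{k=1}^{j-1}\psi(k)$ for $j\ge 4$. The triangular array $\mathcal T=(\mathcal T_{n,j})$, $n\ge 0$, $1\le j\le n+1$, of integers is defined recursively by: $\mathcal T_{n,n+1}=1$ for every $n\ge 0$; $\mathcal T_{1,1}=1$, $\mathcal T_{2,2}=2$, $\mathcal T_{3,3}=3$; $\mathcal T_{n,n}=\sum_{k=1}^{n-2}\mathcal T_{n-k,n-k}$ for every $n\ge 4$; and $\mathcal T_{n,j}=\mathcal T_{n-1,j}+\psi(j)$ for every $n\ge 2$ and $1\le j\le n-1$. The normalised array is $\mathcal T^{(1)}_{n,j}=2^{-n}\mathcal T_{n,j}$. $\mathcal M^\infty$ is the set of infinite right-stochastic matrices $P=(P_{n,j})_{n\ge0,\,j\ge1}$ (non-negative entries, every row summing to $1$) satisfying the following three state-transition characteristics: (i) $\sup_{j\ge1}P_{n,j}=P_{n,n}$ for every $n\ge1$ (the system is at least as likely to remain in its current state as to move to any other one state); (ii) the sequence $[P_{n,n},P_{n,n-1},\dots,P_{n,1}]$ is monotonically non-increasing for every $n\ge1$; (iii) $P_{n,n+k}=0$ for every $k\ge2$ and every $n\ge1$ (only the closest unvisited state can be reached in one step). *)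

(* Defs.v *)
From HB Require Import structures.
From mathcomp Require Import all_boot all_order all_algebra.
From mathcomp Require Import all_classical all_reals all_analysis.

Set Implicit Arguments.
Unset Strict Implicit.
Unset Printing Implicit Defensive.

Import Order.TTheory GRing.Theory Num.Theory.
Import numFieldNormedType.Exports.

Local Open Scope classical_set_scope.
Local Open Scope ring_scope.

(* Columns are numbered from 1, as are psi, the diagonal and the parameter
   sequence lambda. The value of these functions at index 0 is irrelevant:
   no property below reads it. *)

(* psi_seq m = [:: psi 1; ...; psi m]; psi_rec is the defining recursion. *)
Fixpoint psi_seq (m : nat) : seq nat :=
  if m is m'.+1 then
    let s := psi_seq m' in
    rcons s (if (m <= 3)%N then m' else sumn s)
  else [::].

Definition psi (j : nat) : nat := nth 0%N (psi_seq j) j.-1.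

(* diag_seq m = [:: T_{1,1}; ...; T_{m,m}]; the recursion
   T_{n,n} = T_{n-1,n-1} + ... + T_{2,2} leaves out T_{1,1}, whence behead. *)
Fixpoint diag_seq (m : nat) : seq nat :=
  if m is m'.+1 then
    let s := diag_seq m' in
    rcons s (if (m <= 3)%N then m else sumn (behead s))
  else [::].

Definition diag (n : nat) : nat := nth 0%N (diag_seq n) n.-1.

(* Only the entries with 1 <= j <= n + 1 are meaningful. *)
Fixpoint Tarr (n j : nat) : nat :=
  if j == n.+1 then 1%N
  else if j == n then diag n
  else if n is n'.+1 then (Tarr n' j + psi j)%N else 0%N.

Lemma size_psi_seq m : size (psi_seq m) = m.
Proof. by elim: m => //= m IH; rewrite size_rcons IH. Qed.

Lemma size_diag_seq m : size (diag_seq m) = m.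
Proof. by elim: m => //= m IH; rewrite size_rcons IH. Qed.

Lemma nth_psi_seq m i : (i < m)%N -> nth 0%N (psi_seq m) i = psi i.+1.
Proof.
elim: m => // m IH; rewrite ltnS leq_eqVlt => /orP[/eqP -> //|im] /=.
by rewrite nth_rcons size_psi_seq im IH.
Qed.

Lemma nth_diag_seq m i : (i < m)%N -> nth 0%N (diag_seq m) i = diag i.+1.
Proof.
elim: m => // m IH; rewrite ltnS leq_eqVlt => /orP[/eqP -> //|im] /=.
by rewrite nth_rcons size_diag_seq im IH.
Qed.

Lemma psi_init : [/\ psi 1 = 0%N, psi 2 = 1%N & psi 3 = 2%N].
Proof. by []. Qed.

Lemma psi_rec j : (4 <= j)%N -> psi j = (\sum_(1 <= k < j) psi k)%N.
Proof.
case: j => // j j4; rewrite /psi /= nth_rcons size_psi_seq ltnn eqxx.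
rewrite leqNgt j4 /= sumnE (big_nth 0%N) size_psi_seq big_add1 /=.
by apply: eq_big_nat => i /andP[_ ij]; rewrite nth_psi_seq.
Qed.

Lemma TarrE n j : Tarr n j =
  if j == n.+1 then 1%N
  else if j == n then diag n
  else if n is n'.+1 then (Tarr n' j + psi j)%N else 0%N.
Proof. by case: n. Qed.

Lemma Tarr_superdiag n : Tarr n n.+1 = 1%N.
Proof. by rewrite TarrE eqxx. Qed.

Lemma Tarr_init : [/\ Tarr 1 1 = 1%N, Tarr 2 2 = 2%N & Tarr 3 3 = 3%N].
Proof. by []. Qed.

Lemma Tarr_diag n : Tarr n n = diag n.
Proof. by rewrite TarrE eqxx ltn_eqF. Qed.

Lemma Tarr_diag_rec n : (4 <= n)%N ->
  Tarr n n = (\sum_(1 <= k < n.-1) Tarr (n - k) (n - k))%N.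
Proof.
case: n => [|[|n]] // n4; rewrite Tarr_diag {1}/diag.
have -> : diag_seq n.+2 =
    rcons (diag_seq n.+1) (sumn (behead (diag_seq n.+1))).
  by case: n n4 => [|[|n]].
rewrite nth_rcons size_diag_seq ltnn eqxx sumnE (big_nth 0%N).
rewrite size_behead size_diag_seq [n.+1.-1]/= [n.+2.-1]/= big_add1 [n.+1.-1]/=.
rewrite big_nat_rev add0n; apply: eq_big_nat => i /andP[_ ilt].
rewrite Tarr_diag nth_behead nth_diag_seq; last by rewrite ltnS -subSn // subSS leq_subr.
by rewrite subSS -!subSn // ltnW.
Qed.

Lemma Tarr_rec n j : (2 <= n)%N -> (1 <= j <= n.-1)%N ->
  Tarr n j = (Tarr n.-1 j + psi j)%N.
Proof.
case: n => [|n] // _ /andP[_ jn].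
by rewrite TarrE !ltn_eqF // ltnS // leqW.
Qed.

Definition T1 (R : realType) (n j : nat) : R := 2 ^- n * (Tarr n j)%:R.

Definition nstar_pred (R : realType) : pred nat :=
  [pred n | (1 <= n)%N && (0 <= T1 R n n - (n + 2)%:R * T1 R n 1)].

Lemma nstar_exists (R : realType) : exists n, nstar_pred R n.
Proof.
exists 5; apply/andP; split => //.
rewrite /T1 mulrCA -mulrBr mulr_ge0 ?invr_ge0 ?exprn_ge0 //.
by rewrite subr_ge0 -natrM ler_nat.
Qed.

Definition nstar (R : realType) : nat := ex_minn (nstar_exists R).

Definition Q_cube (R : realType) : set (nat -> R) :=
  [set lambda | forall k, (1 <= k)%N -> 0 <= lambda k <= 1].

Definition T1_lambda (R : realType) (lambda : nat -> R) (n j : nat) : R :=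
  if (n.+2 <= j)%N then 0
  else if (n < nstar R)%N then T1 R n j
  else if (j <= n)%N then T1 R n j - lambda n * T1 R n 1
  else T1 R n j + n%:R * lambda n * T1 R n 1.

(* P n j is the entry in row n >= 0 and column j >= 1. *)
Definition right_stochastic (R : realType) (P : nat -> nat -> R) : Prop :=
  (forall n j, (1 <= j)%N -> 0 <= P n j) /\
  (forall n, \sum_(1 <= j < N.+1) P n j @[N --> \oo] --> (1 : R)).

Definition M_infty (R : realType) : set (nat -> nat -> R) :=
  [set P | [/\ right_stochastic P,
    forall n, (1 <= n)%N -> sup [set P n j | j in [set j | (1 <= j)%N]] = P n n,
    (* [:: P n n; P n (n - 1); ...; P n 1] *)
    forall n, (1 <= n)%N -> sorted >=%R (mkseq (fun i => P n (n - i)%N) n) &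
    forall n k, (1 <= n)%N -> (2 <= k)%N -> P n (n + k)%N = 0]].

(* Main.v *)
Require Import Defs.
From mathcomp Require Import all_boot all_order all_algebra.
From mathcomp Require Import all_classical all_reals all_analysis.
From mathcomp Require Import zify lra.

Import Order.TTheory GRing.Theory Num.Theory.

Local Open Scope classical_set_scope.
Local Open Scope ring_scope.

(** Write [c] for the parameter of row [n] (zero below the threshold).  Up to
the factor [2^-n], row [n] of the perturbed array is the integer row
[T_{n,1}, ..., T_{n,n}, 1] in which an amount [c] has been moved from each of
the first [n] entries to the last one, because [T_{n,1} = 1].  Subtracting a
constant preserves the monotonicity of the first [n] entries, and the transfer
preserves the sum of the row.  So everything reduces to facts on integers.

- The row sums to [2^n] ([sum_Tarr]): passing from row [n] to row [n+1] adds
  [psi 1 + ... + psi n] and the new diagonal entry, and these add up to [2^n]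
  ([sum_psi_diag]).
- The row is non-decreasing up to the diagonal ([Tarr_le_step]): column [j]
  grows linearly with slope [psi j] below the diagonal; at height [j+1], where
  column [j+1] starts, its value is at most that of column [j+1], and its slope
  is at most [psi (j+1)].
- The first entry is [1], so that entries stay non-negative for [c <= 1].
- The last entry stays below the diagonal one iff [1 + n c <= diag n - c].
  For [c <= 1] this follows from [n + 2 <= diag n], the condition that defines
  the threshold.  It fails for [n < 5] and holds from [5] on, since the
  diagonal is eventually geometric with ratio [2]; hence once true it remains
  true ([nstar_room]). *)

(** * The integer sequences *)

Lemma psi_geometric m : psi (m + 4) = (3 * 2 ^ m)%N.
Proof.
elim: m => // m IH.
by rewrite addSn psi_rec ?big_nat_recr -?psi_rec ?IH ?expnS /=; lia.
Qed.

Lemma diag_rec n : (4 <= n)%N -> diag n = (\sum_(2 <= k < n) diag k)%N.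
Proof.
move=> n4; rewrite -Tarr_diag Tarr_diag_rec //.
rewrite [RHS]big_nat_rev [RHS](_ : _ = \sum_(1.+1 <= k < n.-1.+1)
  diag (2 + n - k.+1))%N; last by rewrite prednK //; lia.
rewrite [RHS]big_add1 /=.
by apply: eq_big_nat => k _; rewrite Tarr_diag; congr diag; lia.
Qed.

Lemma diag_geometric m : diag (m + 4) = (5 * 2 ^ m)%N.
Proof.
elim: m => // m IH.
by rewrite addSn diag_rec ?big_nat_recr -?diag_rec ?IH ?expnS /=; lia.
Qed.

(** From index [4] on, [psi] and [diag] are [3/16] and [5/16] of the powers of
two, which together make one half. *)
Lemma sum_psi_diag n :
  (\sum_(1 <= k < n.+1) psi k + diag n.+1 = 2 ^ n)%N.
Proof.
have [n3|] := leqP 3 n.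
  rewrite -psi_rec // -(subnK n3) -addnS psi_geometric diag_geometric expnD.
  by lia.
by case: n => [|[|[|]]] // _; rewrite unlock.
Qed.

Lemma psi_le_step j : (1 <= j)%N -> (psi j <= psi j.+1)%N.
Proof.
have [j4 _|] := leqP 4 j; last by case: j => [|[|[|[|]]]].
by rewrite -(subnK j4) -addSn !psi_geometric expnS; lia.
Qed.

(** The left side is the entry below the diagonal in column [j], so this
compares two neighbours in row [j+1]. *)
Lemma psi_diag_le_step j : (1 <= j)%N -> (diag j + psi j <= diag j.+1)%N.
Proof.
have [j4 _|] := leqP 4 j; last by case: j => [|[|[|[|]]]].
by rewrite -(subnK j4) -addSn psi_geometric !diag_geometric expnS; lia.
Qed.

Lemma diag_gt0 n : (1 <= n)%N -> (1 <= diag n)%N.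
Proof.
have [n4 _|] := leqP 4 n; last by case: n => [|[|[|[|]]]].
by rewrite -(subnK n4) diag_geometric muln_gt0 expn_gt0.
Qed.

(** * Rows of the integer array *)

Lemma Tarr_linear j d : (1 <= j)%N ->
  Tarr (j + d) j = (diag j + d * psi j)%N.
Proof.
move=> j1; elim: d => [|d IH]; first by rewrite addn0 Tarr_diag; lia.
by rewrite Tarr_rec addnS /= ?IH; lia.
Qed.

Lemma Tarr1 n : Tarr n 1 = 1%N.
Proof. by case: n => // n; rewrite -add1n Tarr_linear ?muln0. Qed.

Lemma Tarr_le_step n j : (1 <= j < n)%N -> (Tarr n j <= Tarr n j.+1)%N.
Proof.
move=> /andP[j1 jn]; have [d ->] : exists d, n = (j.+1 + d)%N.
  by exists (n - j.+1)%N; rewrite subnKC.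
rewrite Tarr_linear // addSnnS Tarr_linear //.
have := leq_mul (leqnn d) (psi_le_step _ j1).
by have := psi_diag_le_step _ j1; lia.
Qed.

Lemma Tarr_homo n i j : (1 <= i)%N -> (i <= j <= n)%N ->
  (Tarr n i <= Tarr n j)%N.
Proof.
move=> i1; elim: j => [|j IH]; first by lia.
rewrite leq_eqVlt => /andP[/orP[/eqP <- //|ij] jn].
apply: leq_trans (Tarr_le_step _ _ _); last by lia.
by apply: IH; lia.
Qed.

(** Entry by entry, row [n+1] is row [n] without its last [1], increased by
[psi], followed by the new diagonal entry and a new [1]. *)
Lemma sum_Tarr n : (\sum_(1 <= j < n.+2) Tarr n j = 2 ^ n)%N.
Proof.
elim: n => [|n IH]; first by rewrite big_nat1.
move: IH; rewrite big_nat_recr // Tarr_superdiag => IH.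
rewrite big_nat_recr // big_nat_recr // Tarr_superdiag Tarr_diag.
rewrite (eq_big_nat _ _ (F2 := fun j => (Tarr n j + psi j)%N)); last first.
  by move=> j jn; rewrite Tarr_rec //; lia.
by rewrite big_split expnS; have := sum_psi_diag n; move: IH => /=; lia.
Qed.

(** * The threshold *)

Lemma T1_1 (R : realType) n : T1 R n 1 = 2 ^- n.
Proof. by rewrite /T1 Tarr1 mulr1. Qed.

Lemma nstar_predE (R : realType) n :
  nstar_pred R n = (1 <= n)%N && (n + 2 <= diag n)%N.
Proof.
rewrite /nstar_pred /= T1_1 /T1 Tarr_diag [_ * 2 ^- n]mulrC -mulrBr.
by rewrite pmulr_rge0 ?invr_gt0 ?exprn_gt0 // subr_ge0 ler_nat.
Qed.

(** Minimality of the threshold says nothing about later rows: the inequality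
persists because it already forces [n >= 5], where the diagonal is geometric. *)
Lemma nstar_room (R : realType) n : (nstar R <= n)%N -> (n + 2 <= diag n)%N.
Proof.
rewrite /nstar; case: ex_minnP => m; rewrite nstar_predE => + _ mn.
have [m5 _|] := leqP 5 m; last by case: m mn => [|[|[|[|[|]]]]].
have n4 : (4 <= n)%N by lia.
rewrite -(subnK n4) diag_geometric.
by have := ltn_expl (n - 4) (isT : 1 < 2)%N; lia.
Qed.

(** * Rows of the perturbed array *)

(** Extending the parameter by zero below the threshold lets all rows be
treated by the same formulas. *)
Definition transfer {R : realType} (lambda : nat -> R) (n : nat) : R :=
  if (n < nstar R)%N then 0 else lambda n.

Section PerturbedRow.
Variables (R : realType) (lambda : nat -> R).

Lemma T1_lambda_low n j : (j <= n)%N ->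
  T1_lambda lambda n j = 2 ^- n * ((Tarr n j)%:R - transfer lambda n).
Proof.
move=> jn; rewrite /T1_lambda /transfer ltnNge leqW 1?leqW // jn /= T1_1.
by case: ifP; rewrite /T1 ?subr0 // mulrBr [lambda n * _]mulrC.
Qed.

Lemma T1_lambda_superdiag n :
  T1_lambda lambda n n.+1 = 2 ^- n * (1 + n%:R * transfer lambda n).
Proof.
rewrite /T1_lambda /transfer !ltnn T1_1 /T1 Tarr_superdiag.
by case: ifP; rewrite ?mulr0 ?addr0 // mulrDr [_ * 2 ^- n]mulrC.
Qed.

Lemma T1_lambda_out n j : (n.+2 <= j)%N -> T1_lambda lambda n j = 0.
Proof. by rewrite /T1_lambda => ->. Qed.

Lemma sum_T1_lambda n :
  \sum_(1 <= j < n.+2) T1_lambda lambda n j = 1.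
Proof.
rewrite big_nat_recr //= T1_lambda_superdiag.
rewrite (eq_big_nat _ _ (F2 := fun j =>
  2 ^- n * ((Tarr n j)%:R - transfer lambda n))); last first.
  by move=> j /andP[_ jn]; rewrite T1_lambda_low.
rewrite -mulr_sumr -mulrDr sumrB sumr_const_nat subn1 /= -natr_sum.
rewrite addrCA mulr_natl subrK addrC natr1.
have := sum_Tarr n; rewrite big_nat_recr // Tarr_superdiag /= addn1 => ->.
by rewrite natrX mulVf // expf_neq0.
Qed.

Hypothesis lambdaQ : Q_cube lambda.

Lemma nstar_gt0 : (0 < nstar R)%N.
Proof. by rewrite /nstar; case: ex_minnP => -[]. Qed.

Lemma transfer_bounds n : 0 <= transfer lambda n <= 1.
Proof.
rewrite /transfer; case: ltnP => [_|nn]; first by rewrite lexx ler01.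
by apply: lambdaQ; apply: leq_trans nstar_gt0 nn.
Qed.

(** Up to the factor [2^-n], this bounds the entry to the right of the diagonal
by the diagonal one. *)
Lemma transfer_room n : (1 <= n)%N ->
  1 + n%:R * transfer lambda n <= (diag n)%:R - transfer lambda n.
Proof.
move=> n1; have := transfer_bounds n; rewrite /transfer; case: ltnP => [_ _|nn].
  by rewrite mulr0 addr0 subr0 ler1n diag_gt0.
move=> /andP[l0 l1]; have := nstar_room _ _ nn.
rewrite -(ler_nat R) natrD => room.
have : n%:R * lambda n <= n%:R by rewrite ler_piMr.
by lra.
Qed.

Lemma T1_lambda_homo n i j : (1 <= i)%N -> (i <= j <= n)%N ->
  T1_lambda lambda n i <= T1_lambda lambda n j.
Proof.
move=> i1 ijn; have /andP[ij jn] := ijn.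
rewrite !T1_lambda_low //; last exact: leq_trans jn.
by rewrite ler_wpM2l ?invr_ge0 ?exprn_ge0 // lerB // ler_nat Tarr_homo.
Qed.

Lemma T1_lambda_ge0 n j : (1 <= j)%N -> 0 <= T1_lambda lambda n j.
Proof.
move=> j1; have /andP[c0 c1] := transfer_bounds n.
have [/T1_lambda_out -> //|] := leqP n.+2 j.
rewrite ltnS leq_eqVlt => /orP[/eqP ->|jn].
  rewrite T1_lambda_superdiag mulr_ge0 ?invr_ge0 ?exprn_ge0 //.
  by rewrite addr_ge0 ?mulr_ge0.
apply: le_trans (T1_lambda_homo n 1 j _ _) => //; last by rewrite j1.
rewrite T1_lambda_low ?(leq_trans j1) // Tarr1.
by rewrite mulr_ge0 ?invr_ge0 ?exprn_ge0 // subr_ge0.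
Qed.

Lemma T1_lambda_le_diag n j : (1 <= n)%N -> (1 <= j)%N ->
  T1_lambda lambda n j <= T1_lambda lambda n n.
Proof.
move=> n1 j1; have [/T1_lambda_out ->|] := leqP n.+2 j.
  exact: T1_lambda_ge0.
rewrite ltnS leq_eqVlt => /orP[/eqP ->|jn]; last first.
  by apply: T1_lambda_homo => //; rewrite leqnn andbT.
rewrite T1_lambda_superdiag T1_lambda_low // Tarr_diag.
by rewrite ler_wpM2l ?invr_ge0 ?exprn_ge0 // transfer_room.
Qed.

End PerturbedRow.

Theorem proposition2p31 (R : realType) (lambda : nat -> R) :
  Q_cube lambda -> M_infty (T1_lambda lambda).
Proof.
move=> lambdaQ; split.
- split=> [n j|n]; first exact: T1_lambda_ge0.
  (* Rows have finite support, so the partial sums are eventually constant. *)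
  apply: cvg_near_cst; near=> N.
  have nN : (n.+2 <= N.+1)%N by rewrite ltnS; near: N; exact: nbhs_infty_ge.
  rewrite (big_cat_nat _ nN) //= sum_T1_lambda big1_seq ?addr0 // => j.
  by rewrite mem_index_iota => /andP[_ /andP[nj _]]; rewrite T1_lambda_out.
(* The supremum is a maximum, attained on the diagonal. *)
- move=> n n1; apply/eqP; rewrite eq_le; apply/andP; split.
    apply: ge_sup => [|_ [j j1 <-]]; first by exists (T1_lambda lambda n n), n.
    exact: T1_lambda_le_diag.
  apply: ub_le_sup; last by exists n.
  by exists (T1_lambda lambda n n) => _ [j j1 <-]; exact: T1_lambda_le_diag.
- move=> n n1; apply/(sortedP 0) => i; rewrite size_mkseq => ilt.
  rewrite !nth_mkseq //; last exact: ltnW.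
  by apply: T1_lambda_homo; lia.
- by move=> n k _ k2; apply: T1_lambda_out; rewrite -addn2 leq_add2l.
Unshelve. all: by end_near.
Qed.
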